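(* Let $f\in\mathbb{C}[x_1,\dots,x_n]$ be a single polynomial ($\ell=1$) and consider a differential operator $P\in\operatorname{Ann}_{D_n[s]}(f^s)$ which is of degree at most $1$ in $\partial_1,\dots,\partial_n$, i.e. $$P=\sum_{i=1}^np_i(x,s)\cdot\partial_i+q(x,s),\qquad p_1,\dots,p_n,q\in\mathbb{C}[x_1,\dots,x_n,s].$$ Then the following two equalities lead to the same linear relation among the integrals $I_{a,b}$ (in the sense made precise in the context): (i) $\mathfrak{M}\{P\}\bullet\mathfrak{M}\{f^s\}=0$; and (ii) the expansion $\nabla_\omega(\phi)=\sum_{a,b}C_{a,b}(\phi)\cdot f^ax^b\frac{dx}{x}$, which gives $\sum_{a,b}C_{a,b}(\phi)\,I_{a,b}=0$, for the $(n-1)$-form $$\phi=\sum_{i=1}^n(-1)^{i-1}p_i\,\frac{dx_{\widehat{i}}}{x}.$$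
   Context: $f$ is nonzero and not a unit of $\mathbb{C}[x,x^{-1}]$; $X=(\mathbb{C}^* )^n\setminus V(f)$; $\frac{dx}{x}=\frac{dx_1}{x_1}\wedge\cdots\wedge\frac{dx_n}{x_n}$; $dx_{\widehat i}=dx_1\wedge\cdots\wedge dx_{i-1}\wedge dx_{i+1}\wedge\cdots\wedge dx_n$ and $\frac{dx_{\widehat i}}{x}=\frac{dx_{\widehat i}}{x_1\cdots x_n}$. $D_n$ is the Weyl algebra $\mathbb{C}[x_1,\dots,x_n]\langle\partial_1,\dots,\partial_n\rangle$, and $\operatorname{Ann}_{D_n[s]}(f^s)=\{P\in D_n[s]\mid P\bullet f^s=0\}$. Twisted differential: for fixed generic $(s^*,\nu^* )\in\mathbb{C}\times\mathbb{C}^n$, $\omega=s^*\operatorname{dlog}f+\sum_i\nu^*_i\operatorname{dlog}x_i$ and $\nabla_\omega(\phi)=d\phi+\omega\wedge\phi$ on regular differential forms on $X$; in (ii), $s$ is set to $s^*$ in the $p_i$. Integrals: $I_{a,b}=\int_\Gamma f^{s+a}x^{\nu+b}\frac{dx}{x}$, $(a,b)\in\mathbb{Z}\times\mathbb{Z}^n$, where $\Gamma$ is an $n$-cycle with coefficients in the local system of solutions of $d\varphi=\omega\varphi$ (branches of $f^sx^\nu$), continued analytically in $(s,\nu)$; $\mathfrak{M}\{f^s\}=I_{0,0}$. Shift algebra and Mellin transform of operators: $S_n=\mathbb{C}[\nu_1,\dots,\nu_n]\langle\sigma_1^{\pm1},\dots,\sigma_n^{\pm1}\rangle$ with all generators commuting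 except $\sigma_i^{\pm1}\nu_i=(\nu_i\pm1)\sigma_i^{\pm1}$. $\mathfrak{M}\{\cdot\}$ is the $\mathbb{C}[s]$-algebra isomorphism $\mathbb{C}[x^{\pm1}]\langle\theta_1,\dots,\theta_n\rangle[s]\to S_n[s]$, $x_i^{\pm1}\mapsto\sigma_i^{\pm1}$, $\theta_i=x_i\partial_i\mapsto-\nu_i$ (so $\partial_i=x_i^{-1}\theta_i$). $S_n[s]$ acts on the integrals by $\sigma^b\bullet I_{a,0}=I_{a,b}$, with $\nu_i$ and $s$ acting by multiplication. ''Lead to the same linear relation'': the equality (i), written out as $\sum_{a,b}r_{a,b}(s,\nu)I_{a,b}=0$ with $r_{a,b}\in\mathbb{C}(s,\nu)$, and the relation $\sum_{a,b}C_{a,b}(\phi)I_{a,b}=0$ of (ii), for a suitable way of writing $\nabla_\omega(\phi)$ as a combination of the $f^ax^b\frac{dx}{x}$, agree up to a common nonzero scalar factor after evaluating the $r_{a,b}$ at $(s,\nu)=(s^*,\nu^* )$. *)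

(* Defs.v *)
(* The complex numbers are [R[i]] for a [realType] R; the algebraic part is stated
   over any field [K]. *)
From HB Require Import structures.
From mathcomp Require Export all_boot all_order all_algebra finmap.
(* multinomials must be imported before mathcomp-analysis *)
From mathcomp Require Export monalg mpoly complex.
From mathcomp Require Export all_classical all_reals all_analysis.
From mathcomp Require Import ring.

Set Implicit Arguments.
Unset Strict Implicit.
Unset Printing Implicit Defensive.

Import Order.TTheory GRing.Theory Num.Theory numFieldNormedType.Exports.

(* monalg redefines this notation *)
Notation "{ 'mpoly' T [ n ] }" := (mpoly.mpoly n T) : type_scope.

Local Open Scope ring_scope.

Section Biadditive.
Variables (V : zmodType) (op : V -> V -> V) (G : V -> Prop).
Hypothesis opDl : left_distributive op +%R.
Hypothesis opDr : right_distributive op +%R.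
Hypothesis G_ind : forall T : V -> Prop, T 0 ->
  (forall x y, T x -> T y -> T (x + y)) -> (forall x, G x -> T x) ->
  forall x, T x.

Let op0l x : op 0 x = 0.
Proof. by apply: (@addrI _ (op 0 x)); rewrite -opDl !addr0. Qed.
Let op0r x : op x 0 = 0.
Proof. by apply: (@addrI _ (op x 0)); rewrite -opDr !addr0. Qed.

Lemma biadditive_assoc :
  (forall x y z, G x -> G y -> G z -> op x (op y z) = op (op x y) z) ->
  associative op.
Proof.
move=> opA x y z; elim/G_ind: x => [|x x' h h'|x Gx]; first by rewrite !op0l.
  by rewrite !opDl h h'.
elim/G_ind: y => [|y y' h h'|y Gy]; first by rewrite !(op0l, op0r).
  by rewrite opDl !opDr opDl h h'.
elim/G_ind: z => [|z z' h h'|z Gz]; first by rewrite !op0r.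
  by rewrite !opDr h h'.
exact: opA.
Qed.

Lemma biadditive_id1l u : (forall x, G x -> op u x = x) -> left_id u op.
Proof.
by move=> opu; elim/G_ind => // x y h h'; rewrite opDr h h'.
Qed.

Lemma biadditive_id1r u : (forall x, G x -> op x u = x) -> right_id u op.
Proof.
by move=> opu; elim/G_ind => // x y h h'; rewrite opDl h h'.
Qed.
End Biadditive.

Section Biadd.
Variables (V W : zmodType) (opV : V -> V -> V) (opW : W -> W -> W).
Variables (h : {additive V -> W}) (G : V -> Prop).
Hypothesis opVl : left_distributive opV +%R.
Hypothesis opVr : right_distributive opV +%R.
Hypothesis opWl : left_distributive opW +%R.
Hypothesis opWr : right_distributive opW +%R.
Hypothesis G_ind : forall T : V -> Prop, T 0 ->
  (forall x y, T x -> T y -> T (x + y)) -> (forall x, G x -> T x) ->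
  forall x, T x.
Lemma biadditive_morph :
  (forall x y, G x -> G y -> h (opV x y) = opW (h x) (h y)) ->
  {morph h : x y / opV x y >-> opW x y}.
Proof.
move=> hG x y.
have V0l z : opV 0 z = 0 by apply: (@addrI _ (opV 0 z)); rewrite -opVl !addr0.
have V0r z : opV z 0 = 0 by apply: (@addrI _ (opV z 0)); rewrite -opVr !addr0.
have W0l z : opW 0 z = 0 by apply: (@addrI _ (opW 0 z)); rewrite -opWl !addr0.
have W0r z : opW z 0 = 0 by apply: (@addrI _ (opW z 0)); rewrite -opWr !addr0.
elim/G_ind: x => [|x x' e e'|x Gx]; first by rewrite V0l raddf0 W0l.
  by rewrite opVl !raddfD e e' opWl.
elim/G_ind: y => [|y y' e e'|y Gy]; first by rewrite V0r raddf0 W0r.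
  by rewrite opVr !raddfD e e' opWr.
exact: hG.
Qed.
End Biadd.

(* The ring B[y_1, ..., y_n]<z_1^{+-1}, ..., z_n^{+-1}>, in which everything
   commutes except  z_i^{+-1} y_i = (y_i +- e) z_i^{+-1}.  An element is a finitely
   supported family (u_b)_{b in Z^n}, standing for sum_b u_b(y) z^b with the
   coefficients on the left; [e] only enters through the multiplication. *)
Record shift_algebra (B : comNzRingType) (n : nat) (e : int) := ShiftAlgebra {
  sa_val : {malg {mpoly B[n]}['rV[int]_n]}
}.

Section ShiftAlgebraDef.
Variables (B : comNzRingType) (n : nat) (e : int).

Local Notation shift_algebra := (shift_algebra B n e).
Local Notation ShiftAlgebra := (@ShiftAlgebra B n e).
Local Notation sa_val := (@sa_val B n e).

HB.instance Definition _ := [isNew for sa_val].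
HB.instance Definition _ := [Choice of shift_algebra by <:].

Let add P Q := ShiftAlgebra (sa_val P + sa_val Q).
Let opp P := ShiftAlgebra (- sa_val P).
Let addA : associative add.
Proof. by move=> P Q S; rewrite /add addrA. Qed.
Let addC : commutative add.
Proof. by move=> P Q; rewrite /add addrC. Qed.
Let add0 : left_id (ShiftAlgebra 0) add.
Proof. by case=> P; rewrite /add add0r. Qed.
Let addN : left_inverse (ShiftAlgebra 0) opp add.
Proof. by case=> P; rewrite /add /opp addNr. Qed.
HB.instance Definition _ := GRing.isZmodule.Build shift_algebra addA addC add0 addN.

Definition sa_mon (u : {mpoly B[n]}) (b : 'rV[int]_n) : shift_algebra :=
  ShiftAlgebra << u *g b >>.
Definition sa_coef (b : 'rV[int]_n) (P : shift_algebra) : {mpoly B[n]} :=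
  monalg.mcoeff b (sa_val P).
Definition sa_supp (P : shift_algebra) : {fset 'rV[int]_n} :=
  monalg.msupp (sa_val P).

Lemma sa_val_is_zmod_morphism : zmod_morphism sa_val.
Proof. by []. Qed.
HB.instance Definition _ :=
  GRing.isZmodMorphism.Build shift_algebra _ sa_val sa_val_is_zmod_morphism.

Lemma sa_coef_is_zmod_morphism b : zmod_morphism (sa_coef b).
Proof. by move=> P Q; exact: (monalg.mcoeffB b (sa_val P) (sa_val Q)). Qed.
HB.instance Definition _ b := GRing.isZmodMorphism.Build shift_algebra _
  (sa_coef b) (sa_coef_is_zmod_morphism b).

Lemma sa_coefD b P Q : sa_coef b (P + Q) = sa_coef b P + sa_coef b Q.
Proof. exact: raddfD. Qed.

Lemma sa_coefB b P Q : sa_coef b (P - Q) = sa_coef b P - sa_coef b Q.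
Proof. exact: raddfB. Qed.

Lemma sa_coef_mon b u c : sa_coef b (sa_mon u c) = u *+ (c == b).
Proof. exact: mcoeffU. Qed.

Lemma sa_coef_out b P : b \notin sa_supp P -> sa_coef b P = 0.
Proof. exact: mcoeff_outdom. Qed.

Lemma sa_eqP P Q : (forall b, sa_coef b P = sa_coef b Q) -> P = Q.
Proof. by move=> PQ; apply: val_inj; apply/malgP. Qed.

Lemma sa_coef_sum (T : {fset 'rV[int]_n}) (u : 'rV[int]_n -> {mpoly B[n]}) b :
  sa_coef b (\sum_(c <- T) sa_mon (u c) c) = if b \in T then u b else 0.
Proof.
rewrite raddf_sum /=; have [bT|bT] := ifPn.
  rewrite (bigD1_seq b bT (fset_uniq T)) sa_coef_mon eqxx big1 => [|c /negPf cb].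
    exact: addr0.
  by rewrite sa_coef_mon cb.
rewrite big_seq big1 // => c cT; rewrite sa_coef_mon.
by case: eqP cT bT => // -> ->.
Qed.

Lemma sa_decomp P : P = \sum_(b <- sa_supp P) sa_mon (sa_coef b P) b.
Proof.
apply: sa_eqP => b; rewrite (sa_coef_sum _ (sa_coef^~ P)).
by case: ifPn => // /sa_coef_out.
Qed.

Definition is_sa_mon (P : shift_algebra) := exists u b, P = sa_mon u b.

Lemma sa_ind (T : shift_algebra -> Prop) :
  T 0 -> (forall P Q, T P -> T Q -> T (P + Q)) ->
  (forall P, is_sa_mon P -> T P) -> forall P, T P.
Proof.
move=> T0 TD TU P; rewrite [P]sa_decomp; apply: big_ind => // b _.
by apply: TU; do 2!eexists.
Qed.

Definition sa_shift (b : 'rV[int]_n) (p : {mpoly B[n]}) : {mpoly B[n]} :=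
  p \mPo [tuple 'X_i + (e * b 0 i)%:~R | i < n].

Definition sa_mul (P Q : shift_algebra) : shift_algebra :=
  \sum_(b <- sa_supp P) \sum_(c <- sa_supp Q)
    sa_mon (sa_coef b P * sa_shift b (sa_coef c Q)) (b + c).

Lemma sa_mon0 b : sa_mon 0 b = 0.
Proof. by apply: val_inj; exact: monalgU0. Qed.
Lemma sa_monD u v b : sa_mon (u + v) b = sa_mon u b + sa_mon v b.
Proof. by apply: val_inj; exact: monalgUD. Qed.

Lemma shift_zmod_morphism b : zmod_morphism (sa_shift b).
Proof. by move=> p q; rewrite /sa_shift raddfB. Qed.
Lemma shift_monoid_morphism b : monoid_morphism (sa_shift b).
Proof. by split=> [|p q]; rewrite /sa_shift ?rmorph1 ?rmorphM. Qed.
HB.instance Definition _ b :=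
  GRing.isZmodMorphism.Build _ _ (sa_shift b) (shift_zmod_morphism b).
HB.instance Definition _ b :=
  GRing.isMonoidMorphism.Build _ _ (sa_shift b) (shift_monoid_morphism b).

Lemma shiftX b i : sa_shift b 'X_i = 'X_i + (e * b 0 i)%:~R.
Proof. by rewrite /sa_shift comp_mpolyXU -tnth_nth tnth_mktuple. Qed.

Lemma shiftC b c : sa_shift b c%:MP = c%:MP.
Proof. by rewrite /sa_shift comp_mpolyC. Qed.

Lemma rmorph_mpoly_ext (f g : {rmorphism {mpoly B[n]} -> {mpoly B[n]}}) :
  (forall c, f c%:MP = g c%:MP) -> (forall i, f 'X_i = g 'X_i) -> f =1 g.
Proof.
move=> fgC fgX p; rewrite [p]mpolyE !rmorph_sum; apply: eq_bigr => m _.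
rewrite -mul_mpolyC !rmorphM fgC; congr (_ * _).
by rewrite mpolyXE_id !rmorph_prod; apply: eq_bigr => i _; rewrite !rmorphXn fgX.
Qed.

Lemma shift0 p : sa_shift 0 p = p.
Proof.
apply: (rmorph_mpoly_ext (f := sa_shift 0) (g := idfun)) => [c|i] /=.
  exact: shiftC.
by rewrite shiftX mxE mulr0 addr0.
Qed.

Lemma shiftD b c p : sa_shift (b + c) p = sa_shift b (sa_shift c p).
Proof.
apply: (rmorph_mpoly_ext (f := sa_shift (b + c)) (g := sa_shift b \o sa_shift c))
  => [d|i] /=; first by rewrite !shiftC.
by rewrite !shiftX rmorphD /= shiftX rmorph_int mxE mulrDr rmorphD /= addrA.
Qed.

Lemma sa_mulw (S T : {fset 'rV[int]_n}) P Q :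
  (sa_supp P `<=` S)%fset -> (sa_supp Q `<=` T)%fset ->
  sa_mul P Q = \sum_(b <- S) \sum_(c <- T)
    sa_mon (sa_coef b P * sa_shift b (sa_coef c Q)) (b + c).
Proof.
move=> PS QT; rewrite /sa_mul (big_fset_incl _ PS) => [|b _ bP]; last first.
  by apply: big1 => c _; rewrite (sa_coef_out bP) mul0r sa_mon0.
apply: eq_bigr => b _; rewrite (big_fset_incl _ QT) => [//|c _ cQ].
by rewrite (sa_coef_out cQ) rmorph0 mulr0 sa_mon0.
Qed.

Lemma sa_mulDl : left_distributive sa_mul +%R.
Proof.
move=> P P' Q; pose S := (sa_supp P `|` sa_supp P')%fset.
rewrite (@sa_mulw S (sa_supp Q) P) ?fsubsetUl //.
rewrite (@sa_mulw S (sa_supp Q) P') ?fsubsetUr //.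
rewrite (@sa_mulw S (sa_supp Q) (P + P')) ?monalg.msuppD_le //.
rewrite -big_split /=; apply: eq_bigr => b _; rewrite -big_split /=.
by apply: eq_bigr => c _; rewrite -sa_monD -mulrDl -sa_coefD.
Qed.

Lemma sa_mulDr : right_distributive sa_mul +%R.
Proof.
move=> P Q Q'; pose T := (sa_supp Q `|` sa_supp Q')%fset.
rewrite (@sa_mulw (sa_supp P) T P Q) ?fsubsetUl //.
rewrite (@sa_mulw (sa_supp P) T P Q') ?fsubsetUr //.
rewrite (@sa_mulw (sa_supp P) T P (Q + Q')) ?monalg.msuppD_le //.
rewrite -big_split /=; apply: eq_bigr => b _; rewrite -big_split /=.
by apply: eq_bigr => c _; rewrite -sa_monD -mulrDr -raddfD -sa_coefD.
Qed.

Lemma sa_mul_mon u b v c :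
  sa_mul (sa_mon u b) (sa_mon v c) = sa_mon (u * sa_shift b v) (b + c).
Proof.
rewrite (@sa_mulw [fset b]%fset [fset c]%fset) ?msuppU_le //.
by rewrite !big_seq_fset1 !sa_coef_mon !eqxx.
Qed.

Lemma sa_mulA : associative sa_mul.
Proof.
apply: (biadditive_assoc sa_mulDl sa_mulDr sa_ind).
move=> _ _ _ [u [b ->]] [v [c ->]] [w [d ->]].
by rewrite !sa_mul_mon rmorphM /= shiftD mulrA addrA.
Qed.

Lemma sa_mul1l : left_id (sa_mon 1 0) sa_mul.
Proof.
apply: (biadditive_id1l sa_mulDr sa_ind) => _ [u [b ->]].
by rewrite sa_mul_mon mul1r shift0 add0r.
Qed.

Lemma sa_mul1r : right_id (sa_mon 1 0) sa_mul.
Proof.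
apply: (biadditive_id1r sa_mulDl sa_ind) => _ [u [b ->]].
by rewrite sa_mul_mon rmorph1 mulr1 addr0.
Qed.

Lemma sa_oner_neq0 : sa_mon 1 0 != 0.
Proof.
apply/eqP => /(congr1 (sa_coef 0)); rewrite raddf0 sa_coef_mon eqxx.
exact/eqP/oner_neq0.
Qed.

HB.instance Definition _ := GRing.Zmodule_isNzRing.Build shift_algebra
  sa_mulA sa_mul1l sa_mul1r sa_mulDl sa_mulDr sa_oner_neq0.

Lemma sa_monM u b v c :
  sa_mon u b * sa_mon v c = sa_mon (u * sa_shift b v) (b + c).
Proof. exact: sa_mul_mon. Qed.

End ShiftAlgebraDef.

Lemma frac_repr (A : idomainType) (g : {fraction A}) :
  g * tofrac (frac (repr g)).2 = tofrac (frac (repr g)).1.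
Proof.
rewrite -{1}[g]reprK; move: (repr g) => x.
unlock FracField.tofrac; rewrite -[LHS]/(FracField.mul _ _) -FracField.pi_mul.
apply/eqmodP; rewrite /= FracField.equivfE /FracField.mulf.
by rewrite !numden_Ratio ?mulr1 ?mulf_neq0 ?oner_neq0 ?denom_ratioP //= mulrC.
Qed.

Section RationalFunctions.
Variables (B : idomainType) (n : nat).
Local Notation ratfun := {fraction {mpoly B[n]}}.

Definition tofr (p : {mpoly B[n]}) : ratfun := tofrac p.

Definition fderiv (i : 'I_n) (g : ratfun) : ratfun :=
  let u := (repr g).1 in let v := (repr g).2 in
  tofr (mderiv i u * v - u * mderiv i v) / tofr (v ^+ 2).

Definition xmon (b : 'rV[int]_n) : ratfun :=
  \prod_(i < n) tofr 'X_i ^ (b 0 i).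

Lemma fderiv_div i (u v : {mpoly B[n]}) : v != 0 ->
  fderiv i (tofr u / tofr v) =
    tofr (mderiv i u * v - u * mderiv i v) / tofr (v ^+ 2).
Proof.
move=> v0; set g : ratfun := tofr u / tofr v.
have gE : g * tofr v = tofr u by rewrite divfK // tofrac_eq0.
have := frac_repr g; rewrite /fderiv; have := denom_ratioP (repr g).
move: (frac (repr g)) => [u' v'] /= v'0 gE'.
have E : u' * v = u * v'.
  apply/eqP; rewrite -tofrac_eq !tofracM -gE' -[tofrac u]gE /tofr.
  by rewrite mulrAC.
have dE : mderiv i u' * v + u' * mderiv i v = mderiv i u * v' + u * mderiv i v'.
  by rewrite -!mderivM E.
have t0 w : w != 0 -> tofr (w ^+ 2) != 0.
  by move=> w0; rewrite tofrac_eq0 expf_neq0.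
apply/eqP; rewrite eqr_div ?t0 // /tofr -!tofracM tofrac_eq; apply/eqP.
apply/eqP; rewrite -subr_eq0; apply/eqP.
transitivity ((mderiv i u' * v + u' * mderiv i v
               - (mderiv i u * v' + u * mderiv i v')) * (v * v')
  - (u' * v - u * v') * (mderiv i v' * v + mderiv i v * v')); first by ring.
by rewrite E dE !subrr !mul0r subrr.
Qed.

Lemma fderiv_tofr i (u : {mpoly B[n]}) : fderiv i (tofr u) = tofr (mderiv i u).
Proof.
have := @fderiv_div i u 1 (oner_neq0 _).
by rewrite mderivC mulr0 mulr1 subr0 expr1n /tofr tofrac1 !divr1.
Qed.

End RationalFunctions.

(* x_i^{+-1} is [z_i^{+-1}] and theta_i is [y_i]:  x_i theta_i = (theta_i - 1) x_i *)
Notation laurent_weyl K n := (shift_algebra {poly K} n (- 1)).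

(* sigma_i^{+-1} is [z_i^{+-1}] and nu_i is [y_i] *)
Notation shift_ops K n := (shift_algebra {poly K} n 1).

Section Operators.
Variables (K : fieldType) (n : nat).
Local Notation Ks := {poly K}.
Local Notation laurent_weyl := (laurent_weyl K n).
Local Notation shift_ops := (shift_ops K n).

Definition neg_vars (u : {mpoly Ks[n]}) : {mpoly Ks[n]} :=
  u \mPo [tuple - 'X_i | i < n].

Definition mellin (P : laurent_weyl) : shift_ops :=
  \sum_(b <- sa_supp P) sa_mon _ (neg_vars (sa_coef b P)) b.

Lemma neg_vars_zmod : zmod_morphism neg_vars.
Proof. by move=> p q; rewrite /neg_vars raddfB. Qed.
Lemma neg_vars_mon : monoid_morphism neg_vars.
Proof. by split=> [|p q]; rewrite /neg_vars ?rmorph1 ?rmorphM. Qed.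
HB.instance Definition _ := GRing.isZmodMorphism.Build _ _ neg_vars neg_vars_zmod.
HB.instance Definition _ := GRing.isMonoidMorphism.Build _ _ neg_vars neg_vars_mon.

Lemma sa_coef_mellin b (P : laurent_weyl) : sa_coef b (mellin P) = neg_vars (sa_coef b P).
Proof.
rewrite /mellin (sa_coef_sum _ (sa_supp P) (fun c => neg_vars (sa_coef c P))).
by case: ifPn => // /sa_coef_out ->; rewrite raddf0.
Qed.

Lemma mellin_zmod : zmod_morphism mellin.
Proof.
move=> P Q; apply: sa_eqP => b.
rewrite [RHS]sa_coefB [X in _ = X - _]sa_coef_mellin.
rewrite [X in _ = _ - X]sa_coef_mellin [X in X = _]sa_coef_mellin.
rewrite [X in neg_vars X]sa_coefB; exact: (raddfB neg_vars).
Qed.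
HB.instance Definition _ := GRing.isZmodMorphism.Build _ _ mellin mellin_zmod.

Lemma mellin_mon u b : mellin (sa_mon (- 1) u b : laurent_weyl) = sa_mon 1 (neg_vars u) b.
Proof.
apply: sa_eqP => c; rewrite sa_coef_mellin !sa_coef_mon.
by case: eqP => _; rewrite ?raddf0.
Qed.

Lemma neg_vars_sa_shift b u : neg_vars (sa_shift (- 1) b u) = sa_shift 1 b (neg_vars u).
Proof.
have neg_varsX i : neg_vars 'X_i = - 'X_i.
  by rewrite /neg_vars comp_mpolyXU -tnth_nth tnth_mktuple.
have neg_varsC c : neg_vars c%:MP = c%:MP by rewrite /neg_vars comp_mpolyC.
apply: (rmorph_mpoly_ext (f := neg_vars \o sa_shift (- 1) b)
                         (g := sa_shift 1 b \o neg_vars)) => [c|i] /=.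
  by rewrite shiftC !neg_varsC shiftC.
rewrite shiftX rmorphD /= neg_varsX rmorphN /= shiftX rmorph_int opprD.
by rewrite mulN1r mul1r rmorphN.
Qed.

Lemma mellinM : {morph mellin : P Q / P * Q}.
Proof.
apply: (@biadditive_morph laurent_weyl shift_ops *%R *%R mellin _ _ _ _ _ (@sa_ind {poly K} n (- 1))).
- exact: mulrDl.
- exact: mulrDr.
- exact: mulrDl.
- exact: mulrDr.
move=> _ _ [u [b ->]] [v [c ->]].
rewrite (sa_monM _ u b v c); apply: etrans (mellin_mon _ _) _.
apply: etrans (_ : sa_mon 1 (neg_vars u) b * sa_mon 1 (neg_vars v) c = _); last first.
  by congr (_ * _); rewrite -mellin_mon.
by rewrite sa_monM rmorphM /= neg_vars_sa_shift.
Qed.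
Lemma mellin1 : mellin (1 : laurent_weyl) = 1.
Proof. by rewrite [LHS](mellin_mon 1 0) rmorph1. Qed.

Lemma mellin_bij : bijective mellin.
Proof.
have neg_varsK : involutive neg_vars.
  move=> p; apply: (rmorph_mpoly_ext (f := neg_vars \o neg_vars) (g := idfun)) => [c|i] /=.
    by rewrite /neg_vars !comp_mpolyC.
  have neg_varsX : neg_vars 'X_i = - 'X_i.
    by rewrite /neg_vars comp_mpolyXU -tnth_nth tnth_mktuple.
  by rewrite neg_varsX rmorphN /= neg_varsX opprK.
pose g (Q : shift_ops) : laurent_weyl := \sum_(b <- sa_supp Q) sa_mon (- 1) (neg_vars (sa_coef b Q)) b.
have gE b Q : sa_coef b (g Q) = neg_vars (sa_coef b Q).
  rewrite /g (sa_coef_sum _ (sa_supp Q) (fun c => neg_vars (sa_coef c Q))).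
  by case: ifPn => // /sa_coef_out ->; rewrite raddf0.
exists g => P; apply: sa_eqP => b.
  by rewrite gE sa_coef_mellin neg_varsK.
by rewrite sa_coef_mellin gE neg_varsK.
Qed.

Definition expv (m : multinom n) : 'rV[int]_n := \row_i (m i)%:Z.

(* C[x_1, ..., x_n, s] is {mpoly {poly K}[n]}, s being the variable of {poly K} *)
Definition xs_poly (p : {mpoly Ks[n]}) : laurent_weyl :=
  \sum_(m <- mpoly.msupp p) sa_mon _ (mpoly.mcoeff m p)%:MP (expv m).

Definition theta (i : 'I_n) : laurent_weyl := sa_mon _ 'X_i 0.

Definition partial (i : 'I_n) : laurent_weyl :=
  sa_mon _ 1 (- (delta_mx 0 i : 'rV[int]_n)) * theta i.

(* D_n[s] as a subring of C[x^{+-1}]<theta>[s] *)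
Inductive weyl : laurent_weyl -> Prop :=
| weyl_poly p : weyl (xs_poly p)
| weyl_partial i : weyl (partial i)
| weyl_add P Q : weyl P -> weyl Q -> weyl (P + Q)
| weyl_mul P Q : weyl P -> weyl Q -> weyl (P * Q).

Local Notation ratfun := {fraction {mpoly Ks[n]}}.

(* The module generated by the symbol f^s: [g] stands for g f^s, so that
   d_i (g f^s) = (d_i g + s (d_i f / f) g) f^s. *)
Definition theta_fs (f : {mpoly K[n]}) (i : 'I_n) (g : ratfun) : ratfun :=
  let F := tofr (map_mpoly polyC f) in
  tofr 'X_i * (fderiv i g + tofr 'X%:MP * (fderiv i F / F) * g).

(* P = sum_(b, m) c_(b, m)(s) theta^m x^b *)
Definition act_fs (f : {mpoly K[n]}) (P : laurent_weyl) (g : ratfun) : ratfun :=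
  \sum_(b <- sa_supp P) \sum_(m <- mpoly.msupp (sa_coef b P))
    tofr (mpoly.mcoeff m (sa_coef b P))%:MP *
    foldr (fun i => iter (m i) (theta_fs f i)) (xmon Ks b * g) (enum 'I_n).

Definition Ann_fs (f : {mpoly K[n]}) (P : laurent_weyl) : Prop :=
  weyl P /\ act_fs f P 1 = 0.

Definition order1_op (p : 'I_n -> {mpoly Ks[n]}) (q : {mpoly Ks[n]}) :
    laurent_weyl :=
  \sum_(i < n) xs_poly (p i) * partial i + xs_poly q.

End Operators.

Section Forms.
Variables (K : fieldType) (n : nat).
Local Notation ratfun := {fraction {mpoly K[n]}}.

(* Algebraic differential forms with coefficients in C(x), which contains the
   ring C[x^{+-1}, 1/f] of regular functions on X; [a S] is the coefficient of
   dx_(i_1) /\ ... /\ dx_(i_k), where S = {i_1 < ... < i_k}. *)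
Definition diff_form := {ffun {set 'I_n} -> ratfun^o}.

Definition dx (S : {set 'I_n}) : diff_form := [ffun T => (T == S)%:R].

Definition inversions (S T : {set 'I_n}) : nat :=
  #|[set ij : 'I_n * 'I_n | [&& ij.1 \in S, ij.2 \in T & (ij.2 < ij.1)%N]]|.

Definition ext_mul (a b : diff_form) : diff_form :=
  [ffun S : {set 'I_n} => \sum_(T : {set 'I_n} | T \subset S)
     (-1) ^+ inversions T (S :\: T) * a T * b (S :\: T)].

Definition ext_d (a : diff_form) : diff_form :=
  \sum_(i < n) ext_mul (dx [set i]) [ffun S => fderiv i (a S)].

Definition dlog (g : ratfun) : diff_form :=
  g^-1 *: ext_d (g *: dx finset.set0).

Definition omega (f : {mpoly K[n]}) (s : K) (nu : 'rV[K]_n) : diff_form :=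
  tofr s%:MP *: dlog (tofr f) +
  \sum_(i < n) tofr (nu 0 i)%:MP *: dlog (tofr 'X_i).

Definition nabla (w : diff_form) (a : diff_form) : diff_form :=
  ext_d a + ext_mul w a.

(* dx_S / (x_1 ... x_n) *)
Definition dx_over_x (S : {set 'I_n}) : diff_form :=
  (\prod_(i < n) tofr 'X_i)^-1 *: dx S.

Definition at_s (s : K) (p : {mpoly {poly K}[n]}) : {mpoly K[n]} :=
  map_mpoly (horner_eval s) p.

(* indices start at 0, hence the sign (-1)^i *)
Definition phi_form (s : K) (p : 'I_n -> {mpoly {poly K}[n]}) : diff_form :=
  \sum_(i < n) ((-1) ^+ i * tofr (at_s s (p i))) *: dx_over_x (~: [set i]).

Definition expansion (f : {mpoly K[n]}) (c : {malg K[(int * 'rV[int]_n)%type]}) :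
    diff_form :=
  \sum_(ab <- monalg.msupp c)
    (tofr (monalg.mcoeff ab c)%:MP * tofr f ^ ab.1 * xmon K ab.2)
      *: dx_over_x [set: 'I_n].

Definition laurent_poly (h : ratfun) : Prop :=
  exists (g : {mpoly K[n]}) (b : 'rV[int]_n), h = tofr g * xmon K b.

Definition laurent_unit (f : {mpoly K[n]}) : Prop :=
  exists2 h, laurent_poly h & tofr f * h = 1.

End Forms.

Section Relations.
Variables (K : fieldType) (n : nat).

Definition eval_snu (r : {mpoly {poly K}[n]}) (s : K) (nu : 'rV[K]_n) : K :=
  meval (nu 0) (at_s s r).

(* The action of S_n[s] on functions of (s, nu): sigma^b shifts nu by b *)
Definition shift_act (Q : shift_ops K n) (F : K -> 'rV[K]_n -> K) :
    K -> 'rV[K]_n -> K :=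
  fun s nu => \sum_(b <- sa_supp Q)
    eval_snu (sa_coef b Q) s nu * F s (nu + map_mx intr b).

(* Q . I_(0,0) = sum_b r_b(s, nu) I_(0,b)  for  Q = sum_b r_b(s, nu) sigma^b *)
Definition relation_of (Q : shift_ops K n) :
    {malg {mpoly {poly K}[n]}[(int * 'rV[int]_n)%type]} :=
  \sum_(b <- sa_supp Q) << sa_coef b Q *g (0, b) >>.

End Relations.

Section TwistedCycles.
Variables (R : realType) (n : nat) (f : {mpoly R[i][n]}).
Local Notation C := R[i].

Definition cexp (z : C) : C :=
  Complex (expR (complex.Re z) * cos (complex.Im z))
          (expR (complex.Re z) * sin (complex.Im z)).

Definition in_simplex m (t : 'rV[R]_m) : Prop :=
  (forall i, 0 <= t 0 i) /\ \sum_i t 0 i <= 1.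

Definition C1_real m (h : 'rV[R]_m -> R^o) : Prop :=
  (forall t, differentiable h t) /\
  (forall k, continuous (fun t => 'D_(delta_mx 0 k : 'rV[R]_m) h t)).

Definition C1 m (g : 'rV[R]_m -> C) : Prop :=
  C1_real (fun t => complex.Re (g t)) /\ C1_real (fun t => complex.Im (g t)).

Definition pdiff m (k : 'I_m) (g : 'rV[R]_m -> C) (t : 'rV[R]_m) : C :=
  let re : 'rV[R]_m -> R^o := fun u => complex.Re (g u) in
  let im : 'rV[R]_m -> R^o := fun u => complex.Im (g u) in
  Complex ('D_(delta_mx 0 k : 'rV[R]_m) re t)
          ('D_(delta_mx 0 k : 'rV[R]_m) im t).

(* A C^1 singular n-simplex of X together with a branch of f^s x^nu along it.
   The simplex is t |-> (exp (logx i t))_i.  Its coordinates and f do not vanish,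
   so logarithms exist along it, and C^1 functions on the simplex extend to R^n. *)
Record branched_simplex := BranchedSimplex {
  logx : 'I_n -> 'rV[R]_n -> C;
  logf : 'rV[R]_n -> C;
  logx_C1 : forall i, C1 (logx i);
  logf_C1 : C1 logf;
  logfP : forall t, in_simplex t ->
    cexp (logf t) = meval (fun i => cexp (logx i t)) f
}.

Definition branch (D : branched_simplex) (s : C) (nu : 'rV[C]_n)
    (t : 'rV[R]_n) : C :=
  cexp (s * logf D t + \sum_(i < n) nu 0 i * logx D i t).

(* integral over {(t_1, ..., t_m) | t_k >= 0, t_1 + ... + t_m <= h} *)
Fixpoint simplex_int (m : nat) (h : R) (F : seq R -> R) : R :=
  if m is m'.+1 then
    (\int[@lebesgue_measure R]_(t in (`[0%R, h]%classic))
       simplex_int m' (h - t) (fun u => F (t :: u)))%R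
  else F [::].

Definition simplex_Cint (G : 'rV[R]_n -> C) : C :=
  let pt (u : seq R) : 'rV[R]_n := \row_k nth 0 u k in
  Complex (simplex_int n 1 (fun u => complex.Re (G (pt u))))
          (simplex_int n 1 (fun u => complex.Im (G (pt u)))).

(* barycentric coordinates, with index 0 for 1 - u_1 - ... - u_m *)
Definition bary m (u : 'rV[R]_m) (j : nat) : R :=
  if j is j'.+1 then oapp (u 0) 0 (insub j') else 1 - \sum_i u 0 i.

(* inserts 0 as k-th barycentric coordinate *)
Definition face (k : 'I_n.+1) (u : 'rV[R]_n.-1) : 'rV[R]_n :=
  \row_(i < n) (if i.+1 == k then 0 else bary u (unbump k i.+1)).

Definition same_face (D D' : branched_simplex) (k k' : 'I_n.+1) : Prop :=
  forall u, in_simplex u -> forall i,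
    cexp (logx D i (face k u)) = cexp (logx D' i (face k' u)).

Local Notation params := (C^o * 'rV[C^o]_n)%type.

Definition int_shift (a : int) (b : 'rV[int]_n) (z : params) : params :=
  ((z.1 : C) + a%:~R, (z.2 : 'rV[C]_n) + map_mx intr b).

(* A cycle sum_j c_j (D_j (x) f^s x^nu) with coefficients in the local system of
   branches of f^s x^nu, depending holomorphically on (s, nu).  That local system
   only depends on (s, nu) modulo Z^(1 + n), and so do the coefficients c_j: the
   integrands f^(s+a) x^(nu+b) are integrated over the same cycle.
   [tc_closed]: on each (n-1)-dimensional face the sum of the branches vanishes
   (n >= 1, as f is not a unit). *)
Record twisted_cycle := TwistedCycle {
  tc_size : nat;
  tc_simplex : 'I_tc_size -> branched_simplex;
  tc_dom : set params;
  tc_coef : 'I_tc_size -> params -> C^o;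
  tc_open : open tc_dom;
  tc_connected : connected tc_dom;
  tc_analytic : forall j z, tc_dom z -> differentiable (tc_coef j) z;
  tc_dom_shift : forall a b z, tc_dom z -> tc_dom (int_shift a b z);
  tc_coef_shift : forall j a b z, tc_dom z ->
    tc_coef j (int_shift a b z) = tc_coef j z;
  tc_closed : forall z, tc_dom z ->
    forall j0 k0 (u : 'rV[R]_n.-1), in_simplex u ->
    \sum_(j < tc_size)
      \sum_(k < n.+1 | `[< same_face (tc_simplex j) (tc_simplex j0) k k0 >])
        (-1) ^+ k * (tc_coef j z : C) *
        branch (tc_simplex j) z.1 z.2 (face k u) = 0
}.

(* I_(a,b)(s, nu); dx / x pulls back to det (d logx_i / d t_k) dt *)
Definition twisted_integral (G : twisted_cycle) (a : int) (b : 'rV[int]_n)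
    (s : C) (nu : 'rV[C]_n) : C :=
  \sum_(j < tc_size G) (tc_coef j (s, nu) : C) *
    simplex_Cint (fun t =>
      branch (tc_simplex j) (s + a%:~R) (nu + map_mx intr b) t *
      \det (\matrix_(i < n, k < n) pdiff k (logx (tc_simplex j) i) t)).

End TwistedCycles.

(* Main.v *)
(* For a monomial, x^m d_i = (theta_i + 1 - m_i) x^(m - e_i), whose Mellin transform is
   (1 - m_i - nu_i) sigma^(m - e_i).  Hence replacing sigma^b by x^b in M{P} gives
     sum_i ((1 - nu_i) p_i / x_i - d_i p_i) + q.
   On the other side, nabla_omega(phi) is dx/x times
     sum_i (d_i p_i - p_i / x_i + (s d_i f / f + nu_i / x_i) p_i),
   and P . f^s = 0 says  q = - sum_i s (d_i f / f) p_i.  So the two relations agree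
   with factor -1. *)
Require Import Defs.
From HB Require Import structures.
From mathcomp Require Import ring.
Import GRing.Theory Num.Theory.
Local Open Scope ring_scope.
Set Implicit Arguments.
Unset Strict Implicit.
Unset Printing Implicit Defensive.

(** * Additive evaluation of finitely supported families *)

Lemma sum_widen (T : eqType) (V : zmodType) (r1 r2 : seq T) (F : T -> V) :
  uniq r1 -> uniq r2 -> {subset r1 <= r2} ->
  (forall x, x \notin r1 -> F x = 0) ->
  \sum_(x <- r1) F x = \sum_(x <- r2) F x.
Proof.
move=> u1 u2 r12 F0; rewrite [RHS](bigID (mem r1)) /= [X in _ + X]big1 ?addr0 //.
rewrite -[RHS]big_filter; apply: perm_big; apply: uniq_perm => //.
  exact: filter_uniq.
by move=> x; rewrite mem_filter andb_idr // => /r12.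
Qed.

Section FiniteSupport.
Variables (T : choiceType) (A V : zmodType) (h : T -> A -> V).
Hypothesis hB : forall x, zmod_morphism (h x).

Let h0 x : h x 0 = 0.
Proof. by rewrite -(subrr 0) hB subrr. Qed.

(** The additive map assembled from additive maps [h x] on the coefficients. [expansion] and the
    weighted sums of integrals are instances by conversion, so their additivity is settled here
    once. *)
Definition malg_eval (c : {malg A[T]}) : V :=
  \sum_(x <- monalg.msupp c) h x (monalg.mcoeff x c).

Lemma malg_evalB : zmod_morphism malg_eval.
Proof.
move=> c d; pose S := (monalg.msupp c `|` monalg.msupp d)%fset.
have w e : (monalg.msupp e `<=` S)%fset ->
    malg_eval e = \sum_(x <- S) h x (monalg.mcoeff x e).
  move=> /fsubsetP eS; apply: sum_widen => // x xe.
  by rewrite monalg.mcoeff_outdom.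
rewrite !w ?fsubsetUl ?fsubsetUr ?monalg.msuppB_le // -sumrB.
by apply: eq_bigr => x _; rewrite monalg.mcoeffB hB.
Qed.

HB.instance Definition _ := GRing.isZmodMorphism.Build _ _ malg_eval malg_evalB.

Lemma malg_evalU u x : malg_eval << u *g x >> = h x u.
Proof.
rewrite /malg_eval (@sum_widen _ _ _ [:: x]) //.
- by rewrite big_seq1 monalg.mcoeffUU.
- by move=> y /(fsubsetP monalg.msuppU_le); rewrite !inE.
- by move=> y /monalg.mcoeff_outdom ->.
Qed.

Lemma malg_eval_sum (I : Type) (r : seq I) (k : I -> T) (u : I -> A) :
  malg_eval (\sum_(i <- r) << u i *g k i >>) = \sum_(i <- r) h (k i) (u i).
Proof. by rewrite raddf_sum; apply: eq_bigr => i _; exact: malg_evalU. Qed.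

End FiniteSupport.

Section MpolyEval.
Variables (n : nat) (B : nzRingType) (V : zmodType) (h : multinom n -> B -> V).
Hypothesis hB : forall m, zmod_morphism (h m).

Definition mpoly_eval (p : {mpoly B[n]}) : V :=
  \sum_(m <- mpoly.msupp p) h m (mpoly.mcoeff m p).

Lemma mpoly_evalw p r : uniq r -> {subset mpoly.msupp p <= r} ->
  mpoly_eval p = \sum_(m <- r) h m (mpoly.mcoeff m p).
Proof.
move=> ur pr; apply: sum_widen => // m /memN_msupp_eq0 ->.
by rewrite -(subrr (0 : B)) hB subrr.
Qed.

Lemma mpoly_evalB : zmod_morphism mpoly_eval.
Proof.
move=> p q; pose r := undup (mpoly.msupp p ++ mpoly.msupp q).
rewrite !(@mpoly_evalw _ r) ?undup_uniq //.
- by rewrite -sumrB; apply: eq_bigr => m _; rewrite mpoly.mcoeffB hB.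
- by move=> m; rewrite mem_undup mem_cat => ->; rewrite orbT.
- by move=> m; rewrite mem_undup mem_cat => ->.
- by move=> m /mpoly.msuppB_le; rewrite mem_undup.
Qed.

Lemma mpoly_evalD p q : mpoly_eval (p + q) = mpoly_eval p + mpoly_eval q.
Proof.
have E0 : mpoly_eval 0 = 0 by rewrite -(subrr (0 : {mpoly B[n]})) mpoly_evalB subrr.
by rewrite -[q]opprK mpoly_evalB opprK -[- q]sub0r mpoly_evalB E0 sub0r opprK.
Qed.

Lemma mpoly_evalZX c m : mpoly_eval (c *: 'X_[m]) = h m c.
Proof.
rewrite (@mpoly_evalw _ [:: m]) // ?big_seq1 ?mpoly.mcoeffZ ?mpoly.mcoeffX ?eqxx ?mulr1 //.
by move=> m' /mpoly.msuppZ_le; rewrite mpoly.msuppX.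
Qed.
End MpolyEval.

Section ShiftEval.
Variables (B : comNzRingType) (n : nat) (e : int) (V : zmodType).
Variable h : 'rV[int]_n -> {mpoly B[n]} -> V.
Hypothesis hB : forall b, zmod_morphism (h b).

(** The analogue for operators; it covers both the action on f^s and the symbol of a shift
    operator. *)
Definition sa_eval (P : shift_algebra B n e) : V :=
  \sum_(b <- sa_supp P) h b (sa_coef b P).

Lemma sa_evalB : zmod_morphism sa_eval.
Proof. by move=> P Q; exact: (malg_evalB hB (sa_val P) (sa_val Q)). Qed.

HB.instance Definition _ := GRing.isZmodMorphism.Build _ _ sa_eval sa_evalB.

Lemma sa_evalD P Q : sa_eval (P + Q) = sa_eval P + sa_eval Q.
Proof. exact: raddfD. Qed.

Lemma sa_eval_sum (I : Type) (r : seq I) (P : I -> shift_algebra B n e) :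
  sa_eval (\sum_(i <- r) P i) = \sum_(i <- r) sa_eval (P i).
Proof. exact: raddf_sum. Qed.

Lemma sa_eval_mon u b : sa_eval (sa_mon e u b) = h b u.
Proof. exact: (malg_evalU hB). Qed.

End ShiftEval.

(** * Normal form of operators of order at most one *)

Section Order1.
Variables (K : fieldType) (n : nat) (V : zmodType).
Implicit Types (p : 'I_n -> {mpoly {poly K}[n]}) (q : {mpoly {poly K}[n]}).

(** Since x^m d_i = x^(m - e_i) theta_i, moving the monomial to the right of theta_i subtracts its
    i-th exponent m_i - 1 from theta_i. *)
Lemma mon_partial c m (i : 'I_n) :
  sa_mon (- 1) (c%:MP : {mpoly {poly K}[n]}) (expv m) * partial K i =
  sa_mon (- 1) (c%:MP * ('X_i + (1 - (m i)%:R)%:MP)) (expv m - delta_mx 0 i).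
Proof.
rewrite /partial /theta !sa_monM mul1r addr0 !shiftX !mxE !eqxx /=.
rewrite rmorphD /= shiftX rmorph_int mxE mulN1r mulrN1 opprK.
rewrite mpolyCB mpolyC1 mpolyC_nat mulrNz -!pmulrn.
by rewrite -addrA [- _ + _]addrC.
Qed.

(** Additive maps out of the operators need only be known on the terms c (theta_i + 1 - m_i) x^(m -
    e_i) and c x^m. The action on f^s and the Mellin transform are both computed from this
    formula. *)
Lemma sa_eval_order1 (h : 'rV[int]_n -> {mpoly {poly K}[n]} -> V) p q :
  (forall b, zmod_morphism (h b)) ->
  sa_eval h (order1_op p q) =
  \sum_(i < n) \sum_(m <- mpoly.msupp (p i))
     h (expv m - delta_mx 0 i)
       ((mpoly.mcoeff m (p i))%:MP * ('X_i + (1 - (m i)%:R)%:MP)) +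
  \sum_(m <- mpoly.msupp q) h (expv m) (mpoly.mcoeff m q)%:MP.
Proof.
move=> hB; rewrite /order1_op sa_evalD // sa_eval_sum //; congr (_ + _).
  apply: eq_bigr => i _; rewrite /xs_poly mulr_suml sa_eval_sum //.
  by apply: eq_bigr => m _; rewrite mon_partial sa_eval_mon.
by rewrite sa_eval_sum //; apply: eq_bigr => m _; rewrite sa_eval_mon.
Qed.

Lemma sa_eval_mellin (h : 'rV[int]_n -> {mpoly {poly K}[n]} -> V) P :
  (forall b, zmod_morphism (h b)) ->
  sa_eval h (mellin P) = sa_eval (fun b u => h b (neg_vars u)) P.
Proof.
by move=> hB; rewrite sa_eval_sum //; apply: eq_bigr => b _; rewrite sa_eval_mon.
Qed.

End Order1.

(** * Monomials and their derivatives in the field of rational functions *)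

Section Deriv.
Variables (B : idomainType) (n : nat).
Implicit Types (u v : {mpoly B[n]}) (b c : 'rV[int]_n) (i j : 'I_n) (m : multinom n).

HB.instance Definition _ := GRing.RMorphism.copy (@tofr B n) (@tofrac {mpoly B[n]}).

Local Notation X i := (tofr ('X_i : {mpoly B[n]})).
Local Notation Xm m := (tofr ('X_[m] : {mpoly B[n]})).

Lemma mpolyX_neq0 m : ('X_[m] : {mpoly B[n]}) != 0.
Proof. by rewrite -msupp_eq0 mpoly.msuppX. Qed.

Lemma tofrX_neq0 m : Xm m != 0.
Proof. by rewrite tofrac_eq0 mpolyX_neq0. Qed.

Lemma mderivX_mulX i m :
  'X_i * mderiv i ('X_[m] : {mpoly B[n]}) = (m i)%:R *: 'X_[m].
Proof.
rewrite mderivX -scalerAr -mpolyXD; case: (posnP (m i)) => [->|mi].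
  by rewrite !scale0r.
by rewrite addmC submK // lep1mP -lt0n.
Qed.

Lemma mderiv_var i j : mderiv i ('X_j : {mpoly B[n]}) = (i == j)%:R.
Proof.
apply: (@mulfI _ 'X_i); first exact: mpolyX_neq0.
rewrite mderivX_mulX mnm1E eq_sym; case: eqP => [->|_]; first by rewrite scale1r mulr1.
by rewrite scale0r mulr0.
Qed.

Lemma xmonD b c : xmon B (b + c) = xmon B b * xmon B c.
Proof.
rewrite /xmon -big_split; apply: eq_bigr => i _ /=.
by rewrite mxE expfzDr // tofrX_neq0.
Qed.

Lemma xmon_expv m : xmon B (expv m) = Xm m.
Proof.
rewrite /xmon mpolyXE_id rmorph_prod; apply: eq_bigr => i _.
by rewrite mxE rmorphXn.
Qed.

Lemma xmonN_delta i : xmon B (- delta_mx 0 i) = (X i)^-1.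
Proof.
rewrite /xmon (bigD1 i) //= big1 => [|j ji]; rewrite !mxE eqxx ?eqxx /=.
  by rewrite mulr1.
by rewrite (negPf ji).
Qed.

Lemma tofr_expand u :
  tofr u = \sum_(m <- mpoly.msupp u) tofr (mpoly.mcoeff m u)%:MP * Xm m.
Proof.
rewrite [in LHS](mpolyE u) rmorph_sum; apply: eq_bigr => m _.
by rewrite -mul_mpolyC rmorphM.
Qed.

(** The operator x_i d_i is diagonal on Laurent monomials; here the eigenvalue is the exponent m_i -
    1 of x_i in x^(m - e_i). *)
Lemma fderiv_monomial_div i m :
  X i * fderiv i (Xm m / X i) = ((m i)%:R - 1) * (Xm m / X i).
Proof.
have Xi := tofrX_neq0 U_(i).
rewrite fderiv_div ?mpolyX_neq0 // mderiv_var eqxx mulr1 mulrC mulrAC.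
rewrite -mulrA [_ * 'X_i]mulrC mderivX_mulX rmorphB -mul_mpolyC /= rmorphM.
rewrite mpolyC_nat rmorph_nat rmorphXn /=.
by rewrite expr2 invfM mulVKf // [RHS]mulrA [in RHS]mulrBl mul1r.
Qed.

Lemma mul_tofr_expand u (a : {fraction {mpoly B[n]}}) :
  a * tofr u = \sum_(m <- mpoly.msupp u) tofr (mpoly.mcoeff m u)%:MP * (a * Xm m).
Proof.
by rewrite [in LHS]tofr_expand mulr_sumr; apply: eq_bigr => m _; rewrite mulrCA.
Qed.

End Deriv.

(** Used with x = x_i, y = x^(m - e_i), d = d_i y, k = m_i and w = s d_i f / f: the constant 1 - m_i
    cancels the eigenvalue of x_i d_i, so only the logarithmic derivative of f^s survives. *)
Lemma theta_affine (A : comNzRingType) (x d y k w : A) :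
  x * d = (k - 1) * y -> x * (d + w * y) + (1 - k) * y = w * (x * y).
Proof.
move=> xd; transitivity (x * d - (k - 1) * y + w * (x * y)); first by ring.
by rewrite xd subrr add0r.
Qed.

(** * The condition P . f^s = 0 as an equation for q *)

Section Annihilator.
Variables (K : fieldType) (n : nat) (f : {mpoly K[n]}).
Local Notation Ks := {poly K}.
Local Notation ratfun := {fraction {mpoly Ks[n]}}.
Local Notation X i := (tofr ('X_i : {mpoly Ks[n]})).
Implicit Types (g : ratfun).

Definition act_mon g (b : 'rV[int]_n) : {mpoly Ks[n]} -> ratfun :=
  mpoly_eval (fun m c => tofr c%:MP *
    foldr (fun i => iter (m i) (theta_fs f i)) (xmon Ks b * g) (enum 'I_n)).

Lemma act_mon_term_zmod (y : ratfun) :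
  zmod_morphism (fun c : Ks => tofr c%:MP_[n] * y).
Proof. by move=> c d; rewrite mpolyCB rmorphB /= mulrBl. Qed.

Lemma act_mon_zmod g b : zmod_morphism (act_mon g b).
Proof. by apply: mpoly_evalB => m; exact: act_mon_term_zmod. Qed.

Lemma act_fsE P g : act_fs f P g = sa_eval (act_mon g) P.
Proof. by []. Qed.

Lemma foldr_iter0 (T : Type) (t : 'I_n -> T -> T) (y : T) (r : seq 'I_n) :
  foldr (fun i => iter ((0%MM : multinom n) i) (t i)) y r = y.
Proof. by elim: r => //= j r ->; rewrite mnm0E. Qed.

(** The exponent e_i calls for one application of [t i]; [uniq r] prevents a repetition. *)
Lemma foldr_iter1 (T : Type) (t : 'I_n -> T -> T) (y : T) i (r : seq 'I_n) :
  uniq r ->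
  foldr (fun j => iter (U_(i)%MM j) (t j)) y r = if i \in r then t i y else y.
Proof.
elim: r => //= j r IH /andP[jr /IH ->]; rewrite mnm1E in_cons.
by case: eqP => [->|_] //=; rewrite (negPf jr).
Qed.

Lemma act_mon_const g b c : act_mon g b c%:MP = tofr c%:MP * (xmon Ks b * g).
Proof.
have zmod m := act_mon_term_zmod
  (foldr (fun i => iter (m i) (theta_fs f i)) (xmon Ks b * g) (enum 'I_n)).
rewrite -[Y in act_mon _ _ Y]mulr1 -mpolyX0 mul_mpolyC /act_mon mpoly_evalZX //.
by rewrite foldr_iter0.
Qed.

Lemma act_mon_affine g b c d i :
  act_mon g b (c%:MP * ('X_i + d%:MP)) =
  tofr c%:MP * (theta_fs f i (xmon Ks b * g) + tofr d%:MP * (xmon Ks b * g)).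
Proof.
have zmod m := act_mon_term_zmod
  (foldr (fun i => iter (m i) (theta_fs f i)) (xmon Ks b * g) (enum 'I_n)).
rewrite mulrDr -mpolyCM {1}/act_mon mpoly_evalD // -/(act_mon _ _) act_mon_const.
rewrite mul_mpolyC /act_mon mpoly_evalZX // foldr_iter1 ?enum_uniq // mem_enum inE.
by rewrite mpolyCM rmorphM /= -mulrA mulrDr.
Qed.

Local Notation F := (tofr (map_mpoly polyC f)).

(** Applying d_i to f^s gives s (d_i f / f) f^s; the proof finds this monomial by monomial from the
    normal form with theta_i. *)
Lemma act_fs_order1 (p : 'I_n -> {mpoly Ks[n]}) q :
  act_fs f (order1_op p q) 1 =
  \sum_(i < n) tofr 'X%:MP * (fderiv i F / F) * tofr (p i) + tofr q.
Proof.
rewrite act_fsE sa_eval_order1; last exact: act_mon_zmod.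
congr (_ + _); last first.
  rewrite tofr_expand; apply: eq_bigr => m _.
  by rewrite act_mon_const mulr1 xmon_expv.
apply: eq_bigr => i _; rewrite mul_tofr_expand.
apply: eq_bigr => m _; rewrite act_mon_affine mulr1; congr (_ * _).
rewrite xmonD xmon_expv xmonN_delta mpolyCB mpolyC1 mpolyC_nat.
rewrite rmorphB rmorph1 rmorph_nat /= (theta_affine _ (fderiv_monomial_div _ i m)).
by rewrite [X i * _]mulrC divfK // tofrX_neq0.
Qed.

End Annihilator.

(** * Specialization of s *)

Section Specialize.
Variables (K : fieldType) (n : nat) (s : K).
Local Notation Ks := {poly K}.
Implicit Types (p : {mpoly Ks[n]}).

Lemma at_s_zmod : zmod_morphism (@at_s K n s).
Proof. by move=> p q; rewrite /at_s rmorphB. Qed.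
Lemma at_s_monoid : monoid_morphism (@at_s K n s).
Proof. by split=> [|p q]; rewrite /at_s ?rmorph1 ?rmorphM. Qed.
HB.instance Definition _ := GRing.isZmodMorphism.Build _ _ (@at_s K n s) at_s_zmod.
HB.instance Definition _ := GRing.isMonoidMorphism.Build _ _ (@at_s K n s) at_s_monoid.

Lemma at_sC c : at_s s (c%:MP_[n]) = (c.[s])%:MP.
Proof. by rewrite /at_s map_mpolyC. Qed.

Lemma at_s_polyC (f : {mpoly K[n]}) : at_s s (map_mpoly polyC f) = f.
Proof.
by apply/mpolyP => m; rewrite !mcoeff_map_mpoly /= /horner_eval hornerC.
Qed.

Lemma mderiv_map (f : {mpoly K[n]}) i :
  mderiv i (map_mpoly polyC f) = map_mpoly polyC (mderiv i f).
Proof.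
apply/mpolyP => m.
by rewrite mcoeff_map_mpoly !mcoeff_mderiv mcoeff_map_mpoly raddfMn.
Qed.

Lemma map_polyC_neq0 (f : {mpoly K[n]}) : f != 0 -> map_mpoly polyC f != 0.
Proof. by apply: contraNneq => f0; rewrite -[f]at_s_polyC f0 rmorph0. Qed.

Lemma at_s_expand p :
  at_s s p = \sum_(m <- mpoly.msupp p) (mpoly.mcoeff m p).[s] *: 'X_[m].
Proof.
rewrite {1}(mpolyE p) raddf_sum; apply: eq_bigr => m _.
by rewrite /= /at_s map_mpolyZ map_mpolyX.
Qed.

(** Evaluation at s is a morphism on polynomials but not on all their fractions. Hence the equation
    is first multiplied by f, becoming a polynomial identity over K[s], and only then
    specialized. *)
Lemma ann_at_s (f : {mpoly K[n]}) (p : 'I_n -> {mpoly Ks[n]}) q : f != 0 ->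
  act_fs f (order1_op p q) 1 = 0 ->
  \sum_(i < n) s%:MP * mderiv i f * at_s s (p i) + f * at_s s q = 0.
Proof.
move=> f0; rewrite act_fs_order1 => ann.
set F := map_mpoly polyC f in ann.
have F0 : tofr F != 0 by rewrite tofrac_eq0 map_polyC_neq0.
have E : \sum_(i < n) 'X%:MP * mderiv i F * p i + F * q = 0.
  apply/eqP; rewrite -tofrac_eq0 -[tofrac _]/(tofr _) rmorphD rmorph_sum rmorphM /=.
  apply/eqP; apply: etrans (etrans (congr1 (fun g => tofr F * g) ann) (mulr0 _)).
  rewrite /= mulrDr mulr_sumr; congr (_ + _).
  apply: eq_bigr => i _; rewrite fderiv_tofr !rmorphM /= !mulrA; congr (_ * _).
  by apply: (mulIf F0); rewrite divfK // [LHS]mulrC mulrA.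
have /(congr1 (at_s s)) := E; rewrite rmorph0 rmorphD rmorph_sum rmorphM /= at_s_polyC.
move=> E'; apply: etrans E'; congr (_ + _); apply: eq_bigr => i _.
by rewrite !rmorphM /= at_sC hornerX mderiv_map at_s_polyC.
Qed.

End Specialize.

(** * The Mellin transform of P, with sigma^b replaced by x^b *)

Section MellinSide.
Variables (K : fieldType) (n : nat) (s : K) (nu : 'rV[K]_n).
Local Notation Ks := {poly K}.
Local Notation X i := (tofr ('X_i : {mpoly K[n]})).
Local Notation Xm m := (tofr ('X_[m] : {mpoly K[n]})).

Lemma eval_snuB u v : eval_snu (u - v) s nu = eval_snu u s nu - eval_snu v s nu.
Proof. by rewrite /eval_snu !rmorphB. Qed.

Lemma eval_snu0 : eval_snu (0 : {mpoly Ks[n]}) s nu = 0.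
Proof. by rewrite -(subrr (0 : {mpoly Ks[n]})) eval_snuB subrr. Qed.

Lemma eval_snu_sum (I : Type) (r : seq I) (u : I -> {mpoly Ks[n]}) :
  eval_snu (\sum_(i <- r) u i) s nu = \sum_(i <- r) eval_snu (u i) s nu.
Proof.
apply: (big_morph (fun v => eval_snu v s nu) _ eval_snu0) => v w.
by rewrite /eval_snu !rmorphD.
Qed.

Lemma eval_snuC c : eval_snu (c%:MP_[n]) s nu = c.[s].
Proof. by rewrite /eval_snu at_sC mevalC. Qed.

Lemma eval_snu_neg_affine c d i :
  eval_snu (neg_vars (c%:MP_[n] * ('X_i + d%:MP))) s nu = c.[s] * (d.[s] - nu 0 i).
Proof.
rewrite /eval_snu /neg_vars !rmorphM !rmorphD /= !comp_mpolyC comp_mpolyXU.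
rewrite -tnth_nth tnth_mktuple !rmorphN /= !at_sC /at_s map_mpolyX !mevalC mevalXU.
by rewrite addrC.
Qed.

(** Turns a linear relation among the I_(0,b) into a rational function of x, so that it can be
    compared with the coefficient of an n-form. *)
Definition mellin_symbol (P : shift_ops K n) : {fraction {mpoly K[n]}} :=
  \sum_(b <- sa_supp P) tofr (eval_snu (sa_coef b P) s nu)%:MP * xmon K b.

(** In (1 - m_i - nu_i) x^(m - e_i), the part 1 - nu_i sums to (1 - nu_i) p_i / x_i and the part
    -m_i to -d_i p_i. *)
Lemma mellin_symbol_order1 (p : 'I_n -> {mpoly Ks[n]}) q :
  mellin_symbol (mellin (order1_op p q)) =
  \sum_(i < n) (tofr (1 - nu 0 i)%:MP * tofr (at_s s (p i)) / X i
                - tofr (mderiv i (at_s s (p i)))) + tofr (at_s s q).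
Proof.
pose h (b : 'rV[int]_n) (u : {mpoly Ks[n]}) : {fraction {mpoly K[n]}} :=
  tofr (eval_snu u s nu)%:MP * xmon K b.
have hB b : zmod_morphism (h b).
  by move=> u v; rewrite /h eval_snuB mpolyCB rmorphB mulrBl.
have hNB b : zmod_morphism (fun u => h b (neg_vars u)).
  by move=> u v; rewrite raddfB hB.
rewrite -[mellin_symbol _]/(sa_eval h _) sa_eval_mellin // sa_eval_order1 //.
congr (_ + _); last first.
  rewrite at_s_expand rmorph_sum; apply: eq_bigr => m _.
  by rewrite /h /neg_vars comp_mpolyC eval_snuC xmon_expv -mul_mpolyC rmorphM.
(* Multiplication by x_i removes the denominator and makes the derivative diagonal on monomials, so
   coefficients can be compared. *)
apply: eq_bigr => i _; apply: (mulfI (tofrX_neq0 K U_(i))); symmetry.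
rewrite mulrBr mulrC divfK ?tofrX_neq0 // at_s_expand -!rmorphM raddf_sum /=.
rewrite !mulr_sumr -rmorphB -sumrB rmorph_sum; apply: eq_bigr => m _.
rewrite /h eval_snu_neg_affine xmonD xmon_expv xmonN_delta.
rewrite mulrCA [X i * _]mulrC divfK ?tofrX_neq0 // -rmorphM; congr tofr.
rewrite -!mul_mpolyC mderiv_mulC ['X_i * _]mulrCA mderivX_mulX -mul_mpolyC.
have -> : (1 - (m i)%:R : Ks).[s] = 1 - (m i)%:R.
  by rewrite !hornerE -(rmorph_nat (polyC : K -> _)) hornerC.
rewrite !mulrA -!rmorphM -mulrBl -rmorphB; congr (_%:MP * _).
by rewrite [_ * (_).[s]]mulrC -mulrBr addrAC.
Qed.

End MellinSide.

(** * The twisted differential of phi *)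

Lemma mulrCAr (A : comNzRingType) (x y z t : A) : x * (y * z) * t = y * (x * z * t).
Proof. by ring. Qed.

(** Here e = (-1)^i occurs twice: in the coefficient of phi and in dx_i wedge the product of the
    other dx_j. *)
Lemma sign_cancel (A : comNzRingType) (e d u x y w : A) : e ^+ 2 = 1 ->
  e * ((e * d - e * u * x) * y) + e * (w * (e * u * y)) = (d - u * x + w * u) * y.
Proof.
by move=> e2; transitivity (e ^+ 2 * ((d - u * x + w * u) * y));
  [ring | rewrite e2 mul1r].
Qed.

Section Forms.
Variables (K : fieldType) (n : nat).
Local Notation ratfun := {fraction {mpoly K[n]}}.
Local Notation X i := (tofr ('X_i : {mpoly K[n]})).
Local Notation form := (diff_form K n).
Implicit Types (a b w : form) (S T : {set 'I_n}).

Lemma fderiv0 i : fderiv i (0 : ratfun) = 0.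
Proof. by have := fderiv_tofr i (0 : {mpoly K[n]}); rewrite mderiv0 !rmorph0. Qed.

Lemma dxE S T : dx K S T = (T == S)%:R :> ratfun.
Proof. by rewrite ffunE. Qed.

Lemma ext_mul_dx1 i b S :
  ext_mul (dx K [set i]) b S =
  if i \in S then (-1) ^+ inversions [set i] (S :\ i) * (b (S :\ i) : ratfun) else 0.
Proof.
rewrite ffunE; case: ifPn => [iS|iS].
  rewrite (bigD1 [set i]) /=; last by rewrite finset.sub1set.
  rewrite dxE eqxx mulr1 big1 ?addr0 // => T /andP[_ Ti].
  by rewrite dxE (negPf Ti) mulr0 mul0r.
rewrite big1 // => T TS; rewrite dxE; case: eqP => [Ti|_]; last by rewrite mulr0 mul0r.
by move: TS; rewrite Ti finset.sub1set (negPf iS).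
Qed.

Lemma ext_mul_suml (w : 'I_n -> ratfun) (a : 'I_n -> form) b S :
  ext_mul (\sum_i w i *: a i) b S = \sum_i w i * (ext_mul (a i) b S : ratfun).
Proof.
rewrite ffunE; under [RHS]eq_bigr do rewrite ffunE mulr_sumr.
rewrite exchange_big; apply: eq_bigr => T TS /=.
rewrite sum_ffunE mulr_sumr mulr_suml; apply: eq_bigr => i _.
rewrite ffunE -[_ *: _]/((w i : ratfun) * (a i T : ratfun)).
exact: mulrCAr.
Qed.

Lemma inversions0 S : inversions S finset.set0 = 0%N.
Proof.
by apply/eqP; rewrite cards_eq0; apply/eqP/finset.setP => ij; rewrite !inE andbF.
Qed.

(** The inversions are the pairs (i, k) with k < i: dx_i has to pass the i factors before its place,
    indices starting at 0. *)
Lemma inversions1C (i : 'I_n) : inversions [set i] (~: [set i]) = i.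
Proof.
pose g (k : 'I_i) := (i, widen_ord (ltnW (ltn_ord i)) k).
have g_inj : injective g by move=> k l [] E; exact: val_inj.
rewrite -[RHS]card_ord -(card_imset _ g_inj) /inversions; apply: eq_card.
move=> -[j k]; rewrite !inE /=; apply/and3P/imsetP => [[/eqP -> ki lt]|].
  by exists (Ordinal lt) => //; congr (_, _); apply: val_inj.
case=> l _ [-> ->]; split=> //=.
by apply/eqP => /(congr1 val) /= E; have := ltn_ord l; rewrite E ltnn.
Qed.

(** The 0-form g lives on the empty set only, so the coefficient of its differential at S vanishes
    unless S is a singleton. *)
Lemma dlogE (g : ratfun) :
  dlog g = \sum_i (g^-1 * fderiv i g) *: dx K [set i].
Proof.
apply/ffunP => S; rewrite /dlog /ext_d ffunE !sum_ffunE scaler_sumr.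
apply: eq_bigr => i _; rewrite ext_mul_dx1 [RHS]ffunE dxE.
rewrite -[LHS]/(g^-1 * _) -[RHS]/(_ * _ * _) -mulrA; congr (_ * _).
rewrite !ffunE; case: ifPn => iS; last first.
  by case: eqP iS => [->|]; rewrite ?mulr0 // inE eqxx.
have -> : (S == [set i]) = (S :\ i == finset.set0).
  apply/eqP/eqP => [->|Si]; first by rewrite finset.setDv.
  by rewrite -(finset.setD1K iS) Si finset.setU0.
case: eqP => [->|_]; last by rewrite -[_ *: _]/(g * 0) !mulr0 fderiv0 mulr0.
by rewrite inversions0 mul1r -[_ *: _]/(g * 1) !mulr1.
Qed.

Lemma omegaE (f : {mpoly K[n]}) s (nu : 'rV[K]_n) :
  omega f s nu =
  \sum_i (tofr s%:MP * (fderiv i (tofr f) / tofr f) + tofr (nu 0 i)%:MP / X i)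
           *: dx K [set i].
Proof.
rewrite /omega !dlogE scaler_sumr.
under [Y in _ + Y]eq_bigr => j _.
  rewrite dlogE (bigD1 j) //= big1 => [|i ij]; last first.
    by rewrite fderiv_tofr mderiv_var (negPf ij) rmorph0 mulr0 scale0r.
  rewrite addr0 fderiv_tofr mderiv_var eqxx rmorph1 mulr1 scalerA.
  over.
rewrite -big_split; apply: eq_bigr => i _ /=.
by rewrite scalerA -scalerDl [_^-1 * _]mulrC.
Qed.

Local Notation Xprod := (\prod_(i < n) X i).

Lemma XprodE : Xprod = tofr 'X_[[multinom 1%N | i < n]].
Proof.
by rewrite mpolyXE_id rmorph_prod; apply: eq_bigr => i _; rewrite mnmE expr1.
Qed.

(** Every variable has exponent 1 in the product, hence x_i d_i fixes it and the quotient rule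
    contributes -u / x_i. *)
Lemma fderiv_over_Xprod i (u : {mpoly K[n]}) :
  fderiv i (tofr u / Xprod) = (tofr (mderiv i u) - tofr u / X i) / Xprod.
Proof.
have Xi := tofrX_neq0 K U_(i)%MM.
rewrite XprodE fderiv_div ?mpolyX_neq0 //.
set m := mpolyX _ _; have m0 : tofr m != 0 := tofrX_neq0 _ _.
have mE : X i * tofr (mderiv i m) = tofr m.
  by rewrite -rmorphM /= mderivX_mulX mnmE scale1r.
apply: (mulIf m0); apply: (mulIf m0); rewrite divfK // -mulrA -expr2 rmorphXn divfK.
  rewrite rmorphB !rmorphM mulrBl; congr (_ - _).
  by rewrite -mE mulrA (divfK Xi).
by rewrite expf_neq0.
Qed.

Lemma mderiv_sign i k (u : {mpoly K[n]}) :
  mderiv i ((-1) ^+ k * u) = (-1) ^+ k * mderiv i u.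
Proof. by rewrite -signr_odd !mulr_sign; case: (odd k); rewrite ?mderivN. Qed.

Variables (s : K) (nu : 'rV[K]_n) (p : 'I_n -> {mpoly {poly K}[n]}).

Lemma phi_formE i : phi_form s p (~: [set i]) = tofr ((-1) ^+ i * at_s s (p i)) / Xprod.
Proof.
rewrite /phi_form sum_ffunE (bigD1 i) //= big1 ?addr0 => [|j ji].
  rewrite !ffunE eqxx -[LHS]/(_ * (_ * 1)) mulr1.
  by rewrite rmorphM rmorph_sign.
rewrite !ffunE -[LHS]/(_ * (_ * _)); case: eqP => [/finset.setC_inj/finset.set1_inj E|_].
  by rewrite E eqxx in ji.
by rewrite !mulr0.
Qed.

Lemma phi_form0 S : (forall i, S != ~: [set i]) -> phi_form s p S = 0.
Proof.
move=> Sn; rewrite /phi_form sum_ffunE big1 // => i _.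
by rewrite !ffunE (negPf (Sn i)) -[LHS]/(_ * (_ * 0)) !mulr0.
Qed.

(** Common to both halves of [nabla]: D i is d_i for the exterior derivative and multiplication by
    the i-th coefficient of omega for the wedge product. As phi has degree n - 1, only the full set
    S contributes. *)
Lemma ext1_phi S (D : 'I_n -> ratfun -> ratfun) :
  (forall i, D i 0 = 0) ->
  \sum_i (if i \in S then
            (-1) ^+ inversions [set i] (S :\ i) * D i (phi_form s p (S :\ i)) else 0) =
  (S == [set: 'I_n])%:R *
    \sum_(i < n) (-1) ^+ i * D i (tofr ((-1) ^+ i * at_s s (p i)) / Xprod).
Proof.
move=> D0; case: eqP => [->|/eqP ST].
  rewrite mul1r; apply: eq_bigr => i _.
  by rewrite finset.in_setT finset.setTD inversions1C phi_formE.
rewrite mul0r big1 // => i _; case: ifP => // iS.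
(* If S minus i were the complement of j, then i = j, and S, which contains i, would be full. *)
rewrite phi_form0 ?D0 ?mulr0 // => j; apply: contraNneq ST => E.
have : i \notin ~: [set j] by rewrite -E !inE eqxx.
rewrite !inE negbK => /eqP ij.
by rewrite -(finset.setD1K iS) E -ij finset.setUCr.
Qed.

Lemma nabla_phi (f : {mpoly K[n]}) :
  nabla (omega f s nu) (phi_form s p) =
  (\sum_i (tofr (mderiv i (at_s s (p i))) - tofr (at_s s (p i)) / X i
           + (tofr s%:MP * (fderiv i (tofr f) / tofr f) + tofr (nu 0 i)%:MP / X i)
             * tofr (at_s s (p i)))) *: dx_over_x K [set: 'I_n].
Proof.
apply/ffunP => S; rewrite /nabla omegaE [LHS]ffunE ext_mul_suml.
pose w i : ratfun :=
  tofr s%:MP * (fderiv i (tofr f) / tofr f) + tofr (nu 0 i)%:MP / X i.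
(* Moving the factor inside gives omega wedge phi the shape required by [ext1_phi]. *)
have wE i : w i * (ext_mul (dx K [set i]) (phi_form s p) S : ratfun) =
    if i \in S then (-1) ^+ inversions [set i] (S :\ i) *
      (w i * (phi_form s p (S :\ i) : ratfun)) else 0.
  by rewrite ext_mul_dx1; case: ifP => _; rewrite ?mulr0 // mulrCA.
under [Y in _ + Y]eq_bigr do rewrite wE.
rewrite (ext1_phi S (D := fun i g => w i * g)) => [|i]; last by rewrite mulr0.
rewrite sum_ffunE.
under [Y in Y + _]eq_bigr do rewrite ext_mul_dx1 ffunE.
rewrite (ext1_phi S (D := fun i g => fderiv i g)) => [|i]; last exact: fderiv0.
rewrite !ffunE -[RHS]/(_ * (_ * _)) -mulrDr -big_split [RHS]mulrA [RHS]mulrC.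
congr (_ * _).
rewrite mulr_suml; apply: eq_bigr => i _ /=.
rewrite fderiv_over_Xprod mderiv_sign !(rmorphM, rmorph_sign) /=.
apply: sign_cancel; exact: sqrr_sign.
Qed.

End Forms.

(** * Comparison of the two symbols and choice of the expansion *)

Lemma comparison_term (A : comNzRingType) (d u x y w : A) :
  d - u * x + (w + y * x) * u = - ((1 - y) * u * x - d) + w * u.
Proof. by ring. Qed.

Section Comparison.
Variables (K : fieldType) (n : nat) (f : {mpoly K[n]}).
Variables (s : K) (nu : 'rV[K]_n).
Variables (p : 'I_n -> {mpoly {poly K}[n]}) (q : {mpoly {poly K}[n]}).

Lemma nabla_phi_mellin : f != 0 -> act_fs f (order1_op p q) 1 = 0 ->
  nabla (omega f s nu) (phi_form s p) =
  (- mellin_symbol s nu (mellin (order1_op p q))) *: dx_over_x K [set: 'I_n].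
Proof.
move=> f0 /(ann_at_s s f0) ann; rewrite nabla_phi mellin_symbol_order1; congr (_ *: _).
have F0 : tofr f != 0 by rewrite tofrac_eq0.
(* The annihilation condition, divided by f, trades the terms in d_i f / f for -q. *)
have -> : tofr (at_s s q) = - \sum_(i < n)
    tofr s%:MP * (fderiv i (tofr f) / tofr f) * tofr (at_s s (p i)).
  apply: (mulfI F0); apply/eqP; rewrite mulrN -addr_eq0 -rmorphM addrC.
  apply/eqP; apply: etrans (etrans (congr1 (@tofr K n) ann) (rmorph0 _)).
  rewrite rmorphD /=; congr (_ + _); rewrite mulr_sumr rmorph_sum /=.
  apply: eq_bigr => i _.
  rewrite fderiv_tofr !rmorphM /= !mulrA; congr (_ * _).
  by apply: (mulIf F0); rewrite divfK // [RHS]mulrC mulrA.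
rewrite opprD opprK -sumrN -big_split; apply: eq_bigr => i _ /=.
rewrite mpolyCB mpolyC1 rmorphB rmorph1; exact: comparison_term.
Qed.

(** The f^a x^b are linearly dependent, so a way of writing the form has to be chosen. This one has
    a = 0 throughout; the sign is the factor -1 between the two relations. *)
Definition symbol_expansion (Q : shift_ops K n) : {malg K[(int * 'rV[int]_n)%type]} :=
  \sum_(b <- sa_supp Q) << - eval_snu (sa_coef b Q) s nu *g (0, b) >>.

Lemma expansion_symbol Q :
  expansion f (symbol_expansion Q) =
  (- mellin_symbol s nu Q) *: dx_over_x K [set: 'I_n].
Proof.
pose h (ab : int * 'rV[int]_n) (k : K) : diff_form K n :=
  (tofr k%:MP * tofr f ^ ab.1 * xmon K ab.2) *: dx_over_x K [set: 'I_n].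
have hB ab : zmod_morphism (h ab).
  by move=> k l; rewrite /h mpolyCB rmorphB !mulrBl scalerBl.
rewrite -[LHS]/(malg_eval h _) malg_eval_sum // -sumrN scaler_suml.
by apply: eq_bigr => b _; rewrite /h expr0z mulr1 mpolyCN rmorphN mulNr.
Qed.

(** Stated for every index, because the support can shrink when a coefficient of [Q] vanishes at (s,
    nu). *)
Lemma mcoeff_symbol_expansion Q ab :
  monalg.mcoeff ab (symbol_expansion Q) =
  - eval_snu (monalg.mcoeff ab (relation_of Q)) s nu.
Proof.
have -> : monalg.mcoeff ab (relation_of Q) = \sum_(b <- sa_supp Q)
    monalg.mcoeff ab << sa_coef b Q *g (0 : int, b) >> by exact: raddf_sum.
rewrite /symbol_expansion raddf_sum /= eval_snu_sum -sumrN.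
apply: eq_bigr => b _; rewrite !monalg.mcoeffU.
by case: eqP => _; rewrite ?mulr1n // !mulr0n eval_snu0 oppr0.
Qed.

End Comparison.

(** * Passage from symbols to integrals *)

Section Integrals.
Variables (R : realType) (n : nat) (f : {mpoly R[i][n]}) (G : twisted_cycle f).
Implicit Types (s : R[i]) (nu : 'rV[R[i]]_n).
Local Notation I := (twisted_integral G).

(** The coefficients of the cycle are periodic under integer shifts, so shifting nu changes only the
    exponent of the integrand. *)
Lemma twisted_integral_shift b s nu : tc_dom G (s, nu) ->
  I 0 0 s (nu + map_mx intr b) = I 0 b s nu.
Proof.
move=> dom; apply: eq_bigr => j _; congr (_ * _).
  by rewrite -(tc_coef_shift j 0 b dom) /int_shift /= addr0.
by rewrite map_mx0 !addr0.
Qed.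

Lemma shift_act_relation Q s nu : tc_dom G (s, nu) ->
  shift_act Q (I 0 0) s nu =
  \sum_(ab <- monalg.msupp (relation_of Q))
     eval_snu (monalg.mcoeff ab (relation_of Q)) s nu * I ab.1 ab.2 s nu.
Proof.
move=> dom; pose h (ab : int * 'rV[int]_n) u := eval_snu u s nu * I ab.1 ab.2 s nu.
have hB ab : zmod_morphism (h ab) by move=> u v; rewrite /h eval_snuB mulrBl.
rewrite -[RHS]/(malg_eval h _) malg_eval_sum //.
by apply: eq_bigr => b _; rewrite twisted_integral_shift.
Qed.

Lemma sum_symbol_expansion Q s nu : tc_dom G (s, nu) ->
  let c := symbol_expansion s nu Q in
  \sum_(ab <- monalg.msupp c) monalg.mcoeff ab c * I ab.1 ab.2 s nu =
  - shift_act Q (I 0 0) s nu.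
Proof.
move=> dom c; pose h (ab : int * 'rV[int]_n) (k : R[i]) := k * I ab.1 ab.2 s nu.
have hB ab : zmod_morphism (h ab) by move=> k l; rewrite /h mulrBl.
rewrite -[LHS]/(malg_eval h _) malg_eval_sum // -sumrN.
by apply: eq_bigr => b _; rewrite /h mulNr twisted_integral_shift.
Qed.
End Integrals.

Theorem proposition3p11 (R : realType) (n : nat) (f : {mpoly R[i][n]})
    (f_neq0 : f != 0) (f_nonunit : ~ laurent_unit f)
    (p : 'I_n -> {mpoly {poly R[i]}[n]}) (q : {mpoly {poly R[i]}[n]})
    (P_ann : Ann_fs f (order1_op p q))
    (G : twisted_cycle f) (s : R[i]) (nu : 'rV[R[i]]_n)
    (snu_dom : tc_dom G (s, nu)) :
  let MP := mellin (order1_op p q) in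
  let I := twisted_integral G in
  let r := relation_of MP in
  (forall (s' : R[i]) (nu' : 'rV[R[i]]_n), tc_dom G (s', nu') ->
     shift_act MP (I 0 0) s' nu' =
     \sum_(ab <- monalg.msupp r)
        eval_snu (monalg.mcoeff ab r) s' nu' * I ab.1 ab.2 s' nu') /\
  exists (c : {malg R[i][(int * 'rV[int]_n)%type]}) (lambda : R[i]),
    [/\ lambda != 0,
        nabla (omega f s nu) (phi_form s p) = expansion f c,
        forall ab, monalg.mcoeff ab c =
                   lambda * eval_snu (monalg.mcoeff ab r) s nu
      & \sum_(ab <- monalg.msupp c) monalg.mcoeff ab c * I ab.1 ab.2 s nu =
        lambda * shift_act MP (I 0 0) s nu].
Proof.
move=> MP I r; split=> [s' nu' dom|]; first exact: shift_act_relation.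
(* The scalar -1 comes from comparing the symbol of M{P} with the coefficient of dx/x in the twisted
   differential. *)
exists (symbol_expansion s nu MP), (- 1); split.
- by rewrite oppr_eq0 oner_eq0.
- by case: P_ann => _ act0; rewrite expansion_symbol (nabla_phi_mellin s nu f_neq0 act0).
- by move=> ab; rewrite mcoeff_symbol_expansion mulN1r.
- by rewrite sum_symbol_expansion // mulN1r.
Qed.
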